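(* Let $z>0$, let $\Phi$ be the standard normal distribution function, let $f_z$ be the unique bounded solution of the Stein equation $f'(w)-wf(w)=\mathbf{1}(w\le z)-\Phi(z)$, and let $g_z(w)=(wf_z(w))'$, that is, $$g_z(w)=\begin{cases}\left(\sqrt{2\pi}(1+w^2)e^{w^2/2}(1-\Phi(w))-w\right)\Phi(z) & \text{if } w>z,\\ \left(\sqrt{2\pi}(1+w^2)e^{w^2/2}\Phi(w)+w\right)(1-\Phi(z)) & \text{if } w\le z.\end{cases}$$ Then: (i) $g_z(w)$ is increasing for $w\le z$ and decreasing for $w>z$; (ii) $g_z(w)\le \dfrac{3}{2(1-w)^3}$ for all $w<0$; (iii) $g_z(w)\le \dfrac{3}{(1+w)^3}$ for all $w>z$.
   Context: $\Phi(z)=\frac{1}{\sqrt{2\pi}}\int_{-\infty}^z e^{-t^2/2}\,dt$. The function $f_z$ is differentiable except at $w=z$; at $w=z$ the value of $g_z$ is given by the convention in the displayed formula (second case). *)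

(* Defs.v *)
From mathcomp Require Import all_boot all_order all_algebra.
From mathcomp Require Import all_classical all_reals all_analysis.

Set Implicit Arguments.
Unset Strict Implicit.
Unset Printing Implicit Defensive.

Import Order.TTheory GRing.Theory Num.Theory.
Import numFieldNormedType.Exports.

Local Open Scope classical_set_scope.
Local Open Scope ring_scope.

Definition Phi {R : realType} (z : R) : R :=
  (Num.sqrt (2 * pi))^-1 *
  (\int[lebesgue_measure]_(t in `]-oo, z]) expR (- (t ^+ 2 / 2))).

(* The right-hand side of the Stein equation jumps at z, so a solution cannot
   be differentiable there: the equation is required off z, and the pieces are
   tied together by continuity, which determines the value at z. *)
Definition bounded_stein_solution {R : realType} (z : R) (f : R -> R) : Prop :=
  [/\ exists M : R, forall w, `|f w| <= M,
      continuous f &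
      forall w, w != z ->
        derivable f w 1 /\ derive1 f w - w * f w = (w <= z)%R%:R - Phi z].

(* [get] picks the unique element of the set of bounded solutions. *)
Definition stein_sol {R : realType} (z : R) : R -> R :=
  get [set f | bounded_stein_solution z f].

Definition stein_g_formula {R : realType} (z w : R) : R :=
  if w <= z then
    (Num.sqrt (2 * pi) * (1 + w ^+ 2) * expR (w ^+ 2 / 2) * Phi w + w)
      * (1 - Phi z)
  else
    (Num.sqrt (2 * pi) * (1 + w ^+ 2) * expR (w ^+ 2 / 2) * (1 - Phi w) - w)
      * Phi z.

(* x |-> x * stein_sol z x has no derivative at z; there the value is the one
   of the explicit formula. *)
Definition stein_g {R : realType} (z w : R) : R :=
  if w == z then stein_g_formula z z
  else derive1 (fun x : R => x * stein_sol z x) w.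

(* Main.v *)
From HB Require Import structures.
Require Import Defs.
From mathcomp Require Import all_boot all_order all_algebra.
From mathcomp Require Import all_classical all_reals all_analysis.
From mathcomp Require Import ring lra.
Import Order.TTheory GRing.Theory Num.Theory.
Import numFieldNormedType.Exports.
Local Open Scope ring_scope.

(** With M(w) = sqrt(2 pi) e^(w^2/2) Phi(w), which solves M' = w M + 1, and
A(w) = (1 + w^2) M(w) + w, the function g_z is A(w) (1 - Phi(z)) for w <= z and
A(-w) Phi(z) for w > z.  Everything reduces to upper bounds of M on the negative
half-line, and these follow from a comparison principle at -oo: a nonnegative h
with h' > w h + 1 dominates M.  The choice h = -(w^2 + 2) / (w^3 + 3 w) gives
A' > 0, and h = (-w + 3 / (1 - w)^3) / (1 + w^2) gives A(w) <= 3 / (1 - w)^3.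
The bounded solution of the Stein equation is unique because the difference of
two solutions is a multiple of e^(w^2/2). *)

(* Pointwise forms of the differentiation rules: their statements unify with
   functions given as lambda-abstractions, unlike [f + g], [f * g], etc. *)
Section pointwise_derivatives.
Context {R : realType}.
Implicit Types (f g : R -> R) (x df dg : R).

Lemma is_derive_addf {f g x df dg} : is_derive x 1 f df ->
  is_derive x 1 g dg -> is_derive x 1 (fun t => f t + g t) (df + dg).
Proof. exact: is_deriveD. Qed.

Lemma is_derive_oppf {f x df} : is_derive x 1 f df ->
  is_derive x 1 (fun t => - f t) (- df).
Proof. exact: is_deriveN. Qed.

Lemma is_derive_mulf {f g x df dg} : is_derive x 1 f df ->
  is_derive x 1 g dg ->
  is_derive x 1 (fun t => f t * g t) (f x * dg + g x * df).
Proof. exact: is_deriveM. Qed.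

Lemma is_derive_exprf {f} n {x df} : is_derive x 1 f df ->
  is_derive x 1 (fun t => f t ^+ n) (n%:R * f x ^+ n.-1 * df).
Proof.
rewrite (_ : (fun t => _) = f ^+ n) => [|]; first exact: is_deriveX.
by apply/funext => t; rewrite fctE.
Qed.

Lemma is_derive_invf {f x df} : f x != 0 -> is_derive x 1 f df ->
  is_derive x 1 (fun t => (f t)^-1) (- f x ^- 2 * df).
Proof. exact: is_deriveV. Qed.

Lemma is_derive_compf {f g x df dg} : is_derive (g x) 1 f df ->
  is_derive x 1 g dg -> is_derive x 1 (fun t => f (g t)) (df * dg).
Proof. exact: is_derive1_comp. Qed.

Lemma is_derive1_continuous {f x df} : is_derive x 1 f df ->
  {for x, continuous f}%classic.
Proof. by case=> /derivable1_diffP/differentiable_continuous. Qed.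

End pointwise_derivatives.

(* [is_derive] is a class: plain [apply] would let instance resolution fill the
   premises with derivatives in an unusable form. *)
Ltac derive_step :=
  first [ eassumption
        | match goal with |- is_derive _ _ (fun=> _) _ =>
            notypeclasses refine (is_derive_cst _ _ _) end
        | match goal with |- is_derive _ _ (fun t => t) _ =>
            notypeclasses refine (is_derive_id _ _) end
        | match goal with |- is_derive _ _ -%R _ =>
            notypeclasses refine (is_deriveNid _ _) end
        | match goal with |- is_derive _ _ (fun t => - _) _ =>
            notypeclasses refine (is_derive_oppf _) end
        | match goal with |- is_derive _ _ (fun t => _ + _) _ =>
            notypeclasses refine (is_derive_addf _ _) end
        | match goal with |- is_derive _ _ (fun t => _ ^+ _) _ =>
            notypeclasses refine (is_derive_exprf _ _) end
        | match goal with |- is_derive _ _ (fun t => _ * _) _ =>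
            notypeclasses refine (is_derive_mulf _ _) end
        | match goal with |- is_derive _ _ (fun t => expR _) _ =>
            notypeclasses refine (is_derive_compf (f := expR) (is_derive_expR _) _) end ].

(** * The standard normal distribution function *)

Section normal_cdf.
Context {R : realType}.
Implicit Types x y : R.
Local Notation mu := lebesgue_measure.

(** Under [normal_prob 0 1] the identity is a random variable with [cdf] equal to [Phi], so sign and
    limits of [Phi] come from the theory of [cdf]. *)
Let idTR : measurableTypeR R -> R := idfun.

#[local] HB.instance Definition _ :=
  @isMeasurableFun.Build _ _ _ _ idTR (@measurable_id _ _ setT).

Lemma sqrt2pi_gt0 : 0 < Num.sqrt (2 * pi) :> R.
Proof. by rewrite sqrtr_gt0 mulr_gt0// pi_gt0. Qed.

Lemma normal_pdf01E x :
  normal_pdf 0 1 x = (Num.sqrt (2 * pi))^-1 * expR (- (x ^+ 2 / 2)).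
Proof.
rewrite normal_pdfE ?oner_eq0// /normal_peak /normal_fun subr0 expr1n mul1r.
by rewrite mulNr -[pi *+ 2]mulr_natl.
Qed.

Lemma integrable_gauss_density :
  mu.-integrable [set: R]%classic (EFin \o (fun t => expR (- (t ^+ 2 / 2)))).
Proof.
have := @integrable_normal_pdf R 0 1.
move=> /(integrableZl measurableT (Num.sqrt (2 * pi))).
apply: eq_integrable => //= x _.
by rewrite normal_pdf01E -EFinM mulrA divff ?mul1r// gt_eqF// sqrt2pi_gt0.
Qed.

Lemma integrable_gauss_densityNy x :
  mu.-integrable `]-oo, x]%classic (EFin \o (fun t => expR (- (t ^+ 2 / 2)))).
Proof. exact: integrableS integrable_gauss_density. Qed.

Lemma EFin_Phi x :
  (Phi x)%:E = cdf (idTR : {RV (normal_prob (0 : R) 1) >-> R}) x.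
Proof.
rewrite /cdf /distribution /pushforward preimage_id /normal_prob /Phi.
rewrite -RintegralZl//; last exact: integrable_gauss_densityNy.
under eq_Rintegral do rewrite -normal_pdf01E.
rewrite /Rintegral fineK//; apply: integrable_fin_num => //.
exact: integrableS (integrable_normal_pdf _ _).
Qed.

Lemma Phi_ge0 x : 0 <= Phi x.
Proof. by rewrite -lee_fin EFin_Phi cdf_ge0. Qed.

Lemma cvg_PhiNy : (Phi x @[x --> -oo] --> (0 : R))%classic.
Proof.
have := cvg_cdfNy0 (idTR : {RV (normal_prob (0 : R) 1) >-> R}).
rewrite -(_ : EFin \o Phi = cdf _); first by move/fine_cvgP => [].
by apply/funext => x /=; rewrite EFin_Phi.
Qed.

Lemma cvg_Phiy : (Phi x @[x --> +oo] --> (1 : R))%classic.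
Proof.
have := cvg_cdfy1 (idTR : {RV (normal_prob (0 : R) 1) >-> R}).
rewrite -(_ : EFin \o Phi = cdf _); first by move/fine_cvgP => [].
by apply/funext => x /=; rewrite EFin_Phi.
Qed.

Lemma is_derive_gauss_density x :
  is_derive x 1 (fun t => expR (- (t ^+ 2 / 2))) (- x * expR (- (x ^+ 2 / 2))).
Proof.
eapply is_derive_eq; first by repeat derive_step.
by rewrite /=; field.
Qed.

Lemma is_derive_Phi x :
  is_derive x 1 Phi ((Num.sqrt (2 * pi))^-1 * expR (- (x ^+ 2 / 2))).
Proof.
(* The endpoint [x + 1] only leaves room to the right of [x]. *)
have [] := @continuous_FTC1 R (fun t => expR (- (t ^+ 2 / 2))) -oo%O x (x + 1).
- by rewrite ltrDl.
- exact: integrable_gauss_densityNy.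
- by rewrite ltNyr.
- exact: is_derive1_continuous (is_derive_gauss_density x).
move=> dF <-; rewrite derive1E.
rewrite /Phi; have {}dF := derivableP dF.
eapply is_derive_eq; first by repeat derive_step.
by rewrite mulr0 addr0.
Qed.

Lemma Phi_lt x y : x < y -> Phi x < Phi y.
Proof.
move=> xy.
have [c _ e] := MVT xy (fun t _ => is_derive_Phi t)
  (continuous_subspaceT (fun t => is_derive1_continuous (is_derive_Phi t))).
rewrite -subr_gt0 e mulr_gt0 ?subr_gt0// mulr_gt0 ?expR_gt0//.
by rewrite invr_gt0 sqrt2pi_gt0.
Qed.

Lemma Phi_gt0 x : 0 < Phi x.
Proof. by rewrite (le_lt_trans (Phi_ge0 (x - 1)))// Phi_lt// ltrBlDr ltrDl. Qed.

(** The sum [Phi t + Phi (- t)] has zero derivative because the density is even, and it tends to 1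
    at [+oo]. *)
Lemma PhiN x : Phi (- x) = 1 - Phi x.
Proof.
have d t : is_derive t (1 : R) (fun t => Phi t + Phi (- t)) 0.
  have dP := is_derive_Phi t.
  have dPN := is_derive_compf (is_derive_Phi (- t)) (is_deriveNid t 1).
  eapply is_derive_eq; first by repeat derive_step.
  by rewrite sqrrN mulrN1 subrr.
suff : Phi x + Phi (- x) = 1 by move=> <-; rewrite addrC addKr.
have c1 : (Phi t + Phi (- t) @[t --> +oo] --> (1 + 0 : R))%classic.
  apply: cvgD; first exact: cvg_Phiy.
  exact: (cvgNy_compNP Phi _).1 cvg_PhiNy.
rewrite addr0 in c1.
apply: (cvg_unique _ _ c1); first exact: Rhausdorff.
rewrite (_ : (fun t => _) = cst (Phi x + Phi (- x))); first exact: cvg_cst.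
by apply/funext => t /=; exact: is_derive_0_is_cst d.
Qed.

Lemma Phi_lt1 x : Phi x < 1.
Proof. by rewrite -subr_gt0 -PhiN Phi_gt0. Qed.

End normal_cdf.

(** * Upper bounds for the Mills ratio *)

Section mills_ratio.
Context {R : realType}.
Implicit Types u w x y : R.

(** With phi the normal density, this is Phi(w) / phi(w), the usual Mills ratio (1 - Phi) / phi
    taken at [- w]. *)
Definition mills w : R := Num.sqrt (2 * pi) * expR (w ^+ 2 / 2) * Phi w.

Lemma mills_gt0 w : 0 < mills w.
Proof.
by rewrite /mills mulr_gt0 ?Phi_gt0// mulr_gt0 ?expR_gt0// sqrt2pi_gt0.
Qed.

Lemma is_derive_mills w : is_derive w 1 mills (w * mills w + 1).
Proof.
have dP := is_derive_Phi w.
eapply is_derive_eq; first by rewrite /mills; repeat derive_step.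
rewrite /= expRN /mills; field.
by rewrite !gt_eqF ?sqrt2pi_gt0 ?expR_gt0.
Qed.

Lemma continuous_mills : (continuous mills)%classic.
Proof. by move=> w; exact: is_derive1_continuous (is_derive_mills w). Qed.

(** Hypotheses are confined to the half-line below [y], since the supersolutions compared with
    [mills] are differentiable only below some [b]. *)
Lemma gt0_derive_lt (f df : R -> R) x y : x < y ->
  (forall t, t <= y -> is_derive t 1 f (df t)) ->
  (forall t, t <= y -> 0 < df t) -> f x < f y.
Proof.
move=> xy fdf df0.
have [c] : exists2 c, c \in `]x, y[ & f y - f x = df c * (y - x).
  apply: MVT xy _ _ => [t|]; first by rewrite in_itv/= => /andP[_ /ltW/fdf].
  apply: derivable_within_continuous => t.
  by rewrite in_itv/= => /andP[_ /fdf[]].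
rewrite in_itv/= => /andP[_ /ltW/df0 dfc] e.
by rewrite -subr_gt0 e mulr_gt0 ?subr_gt0.
Qed.

(* [mills] solves M' = w M + 1, so [expR (- w^2 / 2) * (h w - mills w)]
   increases for a strict supersolution [h], and its liminf at -oo is
   nonnegative. *)
Lemma mills_lt_supersolution (h dh : R -> R) (b : R) :
  (forall u, u < b -> 0 <= h u) ->
  (forall u, u < b -> is_derive u 1 h (dh u)) ->
  (forall u, u < b -> u * h u + 1 < dh u) ->
  forall w, w < b -> mills w < h w.
Proof.
move=> h0 hdh hlt w wb.
pose K u := expR (- (u ^+ 2 / 2)) * (h u - mills u).
have Klt u v : u < v -> v < b -> K u < K v.
  move=> uv vb.
  apply: (gt0_derive_lt K
    (fun t => expR (- (t ^+ 2 / 2)) * (dh t - (t * h t + 1)))) uv _ _ => t tv.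
    have dht := hdh t (le_lt_trans tv vb).
    have dm := is_derive_mills t.
    eapply is_derive_eq; first by rewrite /K; repeat derive_step.
    by rewrite /=; field.
  by rewrite mulr_gt0 ?expR_gt0// subr_gt0 hlt// (le_lt_trans tv).
(* In this form the first term is nonnegative and the second vanishes at -oo. *)
have KE u : K u = expR (- (u ^+ 2 / 2)) * h u - Num.sqrt (2 * pi) * Phi u.
  rewrite /K /mills expRN; field.
  by rewrite gt_eqF ?expR_gt0.
(* If [h w <= mills w] then [K w <= 0], so [K] stays below the negative number [K (w - 1)] further
   left. Far enough left, [Num.sqrt (2 * pi) * Phi u] is smaller than [- K (w - 1)], which
   contradicts [KE]. *)
rewrite ltNge; apply/negP => hm.
have w1w : w - 1 < w by rewrite ltrBlDr ltrDl.
have K1 : K (w - 1) < 0.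
  rewrite (lt_le_trans (Klt _ _ w1w wb))// /K mulr_ge0_le0 ?expR_ge0//.
  by rewrite subr_le0.
have e0 : 0 < - K (w - 1) / Num.sqrt (2 * pi).
  by rewrite divr_gt0 ?sqrt2pi_gt0// oppr_gt0.
have /cvgrPdist_lt/(_ _ e0) := @cvg_PhiNy R.
move=> [u0 [_ u0P]].
pose u := Num.min (u0 - 1) (w - 2).
have uw1 : u < w - 1 by rewrite gt_min; apply/orP; right; lra.
have uu0 : u < u0 by rewrite gt_min; apply/orP; left; lra.
have := u0P u uu0; rewrite sub0r normrN ger0_norm ?Phi_ge0//.
rewrite ltr_pdivlMr ?sqrt2pi_gt0// mulrC.
have ub : u < b by lra.
have := Klt _ _ uw1 (lt_trans w1w wb); rewrite KE.
have : 0 <= expR (- (u ^+ 2 / 2)) * h u by rewrite mulr_ge0 ?expR_ge0 ?h0.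
by lra.
Qed.

(* The third convergent of the continued fraction of the Mills ratio. *)
Lemma mills_lt_convergent w : w < 0 ->
  mills w < (w ^+ 2 + 2) * (- (w ^+ 3 + 3 * w))^-1.
Proof.
have gt0 u : u < 0 -> 0 < - (u ^+ 3 + 3 * u).
  by move=> u0; have := sqr_ge0 u; nra.
move: w; apply: (mills_lt_supersolution
  (fun u => (u ^+ 2 + 2) * (- (u ^+ 3 + 3 * u))^-1)
  (fun u => (u ^+ 4 + 3 * u ^+ 2 + 6) * (u ^+ 3 + 3 * u) ^- 2)) => u u0.
- by rewrite divr_ge0 ?(ltW (gt0 _ u0))// addr_ge0 ?sqr_ge0.
- have den0 : - (u ^+ 3 + 3 * u) != 0 by rewrite gt_eqF ?gt0.
  have dV := is_derive_invf (f := fun u => - (u ^+ 3 + 3 * u)) den0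
    (is_derive_oppf (is_derive_addf (is_derive_exprf 3 (is_derive_id u 1))
      (is_derive_mulf (is_derive_cst (3 : R) u 1) (is_derive_id u 1)))).
  eapply is_derive_eq; first by repeat derive_step.
  by rewrite oppr_eq0 in den0; rewrite /=; field.
- have den0 : u ^+ 3 + 3 * u != 0 by rewrite -oppr_eq0 gt_eqF ?gt0.
  rewrite -subr_gt0 (_ : _ - _ = 6 * (u ^+ 3 + 3 * u) ^- 2).
    by rewrite mulr_gt0// invr_gt0 exprn_even_gt0.
  by field.
Qed.

(** The supersolution is found by solving (1 + w^2) h + w = 3 / (1 - w)^3 for h. *)
Lemma mills_lt_cubic w : w < 0 ->
  mills w < (- w + 3 * ((1 - w) ^+ 3)^-1) * (1 + w ^+ 2)^-1.
Proof.
move: w; apply: (mills_lt_supersolution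
  (fun u => (- u + 3 * ((1 - u) ^+ 3)^-1) * (1 + u ^+ 2)^-1)
  (fun u => (-1 + 9 * (1 - u) ^- 4) * (1 + u ^+ 2)^-1
    - (- u + 3 * ((1 - u) ^+ 3)^-1) * (2 * u) * (1 + u ^+ 2) ^- 2)) => u u0.
all: have u1 : 0 < 1 - u by lra.
all: have u2 : 0 < 1 + u ^+ 2 by have := sqr_ge0 u; lra.
all: have /lt0r_neq0 n1 := u1.
all: have /lt0r_neq0 n2 := u2.
- rewrite mulr_ge0 ?invr_ge0 ?(ltW u2)// addr_ge0//; first by lra.
  by rewrite mulr_ge0// invr_ge0 exprn_ge0// ltW.
- have n3 : (1 - u) ^+ 3 != 0 by rewrite expf_neq0.
  have d1 := is_derive_invf (f := fun u => (1 - u) ^+ 3) n3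
    (is_derive_exprf 3 (is_derive_addf (is_derive_cst (1 : R) u 1)
      (is_derive_oppf (is_derive_id u 1)))).
  have d2 := is_derive_invf (f := fun u => 1 + u ^+ 2) n2
    (is_derive_addf (is_derive_cst (1 : R) u 1)
      (is_derive_exprf 2 (is_derive_id u 1))).
  eapply is_derive_eq; first by repeat derive_step.
  by rewrite /=; field; rewrite n1 n2.
- rewrite -subr_gt0 (_ : _ - _ =
    (u ^+ 4 + 5 * u ^+ 3 + 6 * u ^+ 2 - u + 7)
      * ((1 - u) ^+ 4 * (1 + u ^+ 2) ^+ 2)^-1).
    rewrite divr_gt0// ?mulr_gt0 ?exprn_gt0//.
    (* Completing the square settles -3 <= u < 0. For u < -3 the three leading terms of the quartic
       factor as u^2 (u + 2) (u + 3), with both linear factors negative. *)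
    rewrite (_ : _ + 7 = (u * (u + 5 / 2)) ^+ 2 + (7 - u - u ^+ 2 / 4)); last by field.
    have [u3|u3] := leP (-3) u.
      have : 0 < 7 - u - u ^+ 2 / 4 by nra.
      by have := sqr_ge0 (u * (u + 5 / 2)); lra.
    have : 0 <= u ^+ 2 * ((u + 2) * (u + 3)).
      by rewrite mulr_ge0 ?sqr_ge0// mulr_le0//; lra.
    by lra.
  by field; rewrite n1 n2.
Qed.

(** The derivative t M + 1 is positive for t >= 0; for t < 0 the convergent gives -t M < (t^2 + 2) /
    (t^2 + 3) < 1. *)
Lemma mills_lt u w : u < w -> mills u < mills w.
Proof.
move=> uw; apply: (gt0_derive_lt _ _ _ _ uw (fun t _ => is_derive_mills t)).
move=> t _; have := mills_gt0 t; have [t0|t0 m0] := ltP t 0; last by nra.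
have := mills_lt_convergent _ t0; rewrite ltr_pdivlMr => [|]; last by nra.
by have := sqr_ge0 t; nra.
Qed.

(** This is the derivative of w M(w), by M' = w M + 1. *)
Definition stein_profile w : R := (1 + w ^+ 2) * mills w + w.

Lemma is_derive_stein_profile w : is_derive w 1 stein_profile
  ((w ^+ 3 + 3 * w) * mills w + w ^+ 2 + 2).
Proof.
have dm := is_derive_mills w.
eapply is_derive_eq; first by rewrite /stein_profile; repeat derive_step.
by rewrite /=; ring.
Qed.

(** For t < 0, positivity of the derivative is exactly [mills_lt_convergent] with the denominator
    cleared; for t >= 0 every term is nonnegative and the constant is 2. *)
Lemma stein_profile_lt u w : u < w -> stein_profile u < stein_profile w.
Proof.
move=> uw.
apply: (gt0_derive_lt _ _ _ _ uw (fun t _ => is_derive_stein_profile t)) => t _.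
have m0 := mills_gt0 t; have [t0|t0] := ltP t 0; last first.
  have : 0 <= (t ^+ 3 + 3 * t) * mills t.
    by rewrite mulr_ge0 ?(ltW m0)// addr_ge0 ?exprn_ge0 ?mulr_ge0.
  by have := sqr_ge0 t; lra.
have := mills_lt_convergent _ t0; rewrite ltr_pdivlMr => [|]; last first.
  by have := sqr_ge0 t; nra.
by lra.
Qed.

Lemma stein_profile_le w : w < 0 -> stein_profile w <= 3 / (1 - w) ^+ 3.
Proof.
move=> w0; have := mills_lt_cubic _ w0; rewrite ltr_pdivlMr => [|].
  by rewrite /stein_profile mulrC => /ltW; lra.
by have := sqr_ge0 w; lra.
Qed.

End mills_ratio.

(** * The bounded solution of the Stein equation and its uniqueness *)

Section stein_solution.
Context {R : realType}.
Implicit Types z w : R.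

(* Equals [mills w * (1 - Phi z)] for [w <= z] and [mills (- w) * Phi z] for
   [z <= w]; written with [min] and [max] so that continuity and boundedness
   are immediate. *)
Definition stein_fun z w : R :=
  mills (Num.min w z) * mills (- Num.max w z)
    / (Num.sqrt (2 * pi) * expR (z ^+ 2 / 2)).

Lemma sqrt2pi_expR_gt0 z : 0 < Num.sqrt (2 * pi) * expR (z ^+ 2 / 2) :> R.
Proof. by rewrite mulr_gt0 ?sqrt2pi_gt0 ?expR_gt0. Qed.

Lemma stein_fun_le z w : w <= z -> stein_fun z w = mills w * (1 - Phi z).
Proof.
move=> wz; rewrite /stein_fun min_l// max_r// -PhiN -mulrA.
congr (_ * _); rewrite /mills sqrrN mulrAC.
by rewrite divff ?mul1r// gt_eqF// sqrt2pi_expR_gt0.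
Qed.

Lemma stein_fun_ge z w : z <= w -> stein_fun z w = mills (- w) * Phi z.
Proof.
move=> zw; rewrite /stein_fun min_r// max_l// (mulrC (mills z)) -mulrA.
congr (_ * _); rewrite /mills mulrAC.
by rewrite divff ?mul1r// gt_eqF// sqrt2pi_expR_gt0.
Qed.

Lemma continuous_stein_fun z : (continuous (stein_fun z))%classic.
Proof.
have cm (f : R -> R) w : {for w, continuous f}%classic ->
    {for w, continuous (mills \o f)}%classic.
  by move=> cf; apply: continuous_comp cf _; exact: continuous_mills.
move=> w; rewrite /stein_fun; apply: cvgM; last exact: cvg_cst.
apply: cvgM; first apply: (cm (fun t => Num.min t z)).
  by apply: (@continuous_min _ _ idfun (cst z));
    [exact: cvg_id|exact: cvg_cst].
apply: (cm (fun t => - Num.max t z)); apply: cvgN.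
by apply: (@continuous_max _ _ idfun (cst z));
  [exact: cvg_id|exact: cvg_cst].
Qed.

(** As [mills] increases, both factors of the numerator are largest at w = z. *)
Lemma stein_fun_bounded z w : `|stein_fun z w| <=
  mills z * mills (- z) / (Num.sqrt (2 * pi) * expR (z ^+ 2 / 2)).
Proof.
have leM u v : u <= v -> mills u <= mills v :> R.
  by rewrite le_eqVlt => /predU1P[->//|/mills_lt/ltW].
have m0 u : 0 <= mills u :> R by exact/ltW/mills_gt0.
have c0 := ltW (sqrt2pi_expR_gt0 z).
rewrite ger0_norm; last by rewrite divr_ge0// mulr_ge0.
rewrite /stein_fun ler_wpM2r ?invr_ge0// ler_pM// leM//.
  by rewrite ge_min lexx orbT.
by rewrite lerN2 le_max lexx orbT.
Qed.

Lemma is_derive_stein_fun z w : w != z ->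
  is_derive w 1 (stein_fun z) (w * stein_fun z w + ((w <= z)%R%:R - Phi z)).
Proof.
case: ltgtP => // [wz|zw] _.
- have dm := is_derive_mills w.
  (* Off z the function agrees with a single branch in a neighbourhood, so that branch can be
     differentiated instead. *)
  apply: (@near_eq_is_derive _ _ _ (fun t => mills t * (1 - Phi z))).
    near=> t; rewrite stein_fun_le//; near: t.
    by apply: filterS (lt_nbhsl wz) => t /ltW.
  eapply is_derive_eq; first by repeat derive_step.
  by rewrite stein_fun_le ?ltW//=; ring.
- have dm := is_derive_compf (is_derive_mills (- w)) (is_deriveNid w 1).
  apply: (@near_eq_is_derive _ _ _ (fun t => mills (- t) * Phi z)).
    near=> t; rewrite stein_fun_ge//; near: t.
    by apply: filterS (lt_nbhsr zw) => t /ltW.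
  eapply is_derive_eq; first by repeat derive_step.
  by rewrite stein_fun_ge ?ltW//=; ring.
Unshelve. all: by end_near. Qed.

Lemma stein_fun_solution z : bounded_stein_solution z (stein_fun z).
Proof.
split; first by eexists => w; exact: stein_fun_bounded.
  exact: continuous_stein_fun.
move=> w /is_derive_stein_fun[df dfE]; split; first exact: df.
by rewrite derive1E dfE addrC addKr.
Qed.

(* The difference of two solutions is a multiple of [expR (w ^+ 2 / 2)]. *)
Lemma bounded_stein_solution_unique z (f g : R -> R) :
  bounded_stein_solution z f -> bounded_stein_solution z g -> f = g.
Proof.
move=> [[Bf fB] cf df] [[Bg gB] cg dg].
pose D u := expR (- (u ^+ 2 / 2)) * (f u - g u).
(* The Stein equations cancel in D' away from z. Only the open interval must avoid z: continuity
   allows z as an endpoint, so both sides of z share the constant [D z]. *)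
have D_eq a b : a < b -> (forall u, u \in `]a, b[ -> u != z) -> D a = D b.
  move=> ab zab.
  have [c _] : exists2 c, c \in `]a, b[ & D b - D a = 0 * (b - a).
    apply: (@MVT _ D (fun=> 0)) => // [u /zab uz|].
      have [/derivableP dfu] := df u uz; rewrite derive1E => ef.
      have [/derivableP dgu] := dg u uz; rewrite derive1E => eg.
      eapply is_derive_eq; first by rewrite /D; repeat derive_step.
      have {}ef : 'D_1 f u = u * f u + ((u <= z)%R%:R - Phi z) by lra.
      have {}eg : 'D_1 g u = u * g u + ((u <= z)%R%:R - Phi z) by lra.
      by rewrite /= ef eg; field.
    apply: continuous_subspaceT => u; apply: cvgM.
      exact: is_derive1_continuous (is_derive_gauss_density u).
    by apply: cvgB; [exact: cf|exact: cg].
  by rewrite mul0r => /eqP; rewrite subr_eq0 eq_sym => /eqP.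
have Dz w : D w = D z.
  case: (ltgtP w z) => [wz|zw|-> //]; last symmetry; apply: D_eq => // u;
    rewrite in_itv/= => /andP[? ?]; first by rewrite lt_eqF.
  by rewrite gt_eqF.
have [c fgE] : exists c, forall w, f w - g w = c * expR (w ^+ 2 / 2).
  exists (D z) => w; rewrite -(Dz w) /D expRN.
  by rewrite mulrAC mulVf ?mul1r// gt_eqF// expR_gt0.
(* From e^x >= 1 + x: a nonzero multiple of [expR (w ^+ 2 / 2)] grows at least quadratically. *)
have bnd w : `|c| * (1 + w ^+ 2 / 2) <= Bf + Bg.
  apply: (@le_trans _ _ (`|f w - g w|)); last first.
    by rewrite (le_trans (ler_normB _ _))// lerD.
  by rewrite fgE normrM (ger0_norm (expR_ge0 _)) ler_wpM2l// expR_ge1Dx.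
suff c0 : c = 0.
  by apply/funext => w; apply/eqP; rewrite -subr_eq0 fgE c0 mul0r.
apply/eqP/negPn/negP => cn0.
have nc0 : 0 < `|c| by rewrite normr_gt0.
have B0 : 0 <= Bf + Bg by rewrite (le_trans _ (bnd 0))// expr0n mul0r addr0 mulr1.
(* At w = 1 + 2 q, with q the quotient named below, the bound would read 1 + w^2 / 2 <= q, although
   the left side is 3/2 + 2 q + 2 q^2. *)
have := bnd (1 + 2 * (Bf + Bg) / `|c|).
set q := (Bf + Bg) / `|c|.
have q0 : 0 <= q by rewrite divr_ge0.
have -> : Bf + Bg = q * `|c| by rewrite divfK// gt_eqF.
rewrite mulrC ler_pM2r// -mulrA mulfK ?gt_eqF//.
by nra.
Qed.

Lemma stein_solE z : stein_sol z = stein_fun z.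
Proof.
apply: (@bounded_stein_solution_unique z); last exact: stein_fun_solution.
have sol := stein_fun_solution z.
exact: (@getPex _ [set f | bounded_stein_solution z f] (ex_intro _ _ sol)).
Qed.

(** At z this is the convention. Elsewhere the product rule gives w f' + f, and the Stein equation
    eliminates f'. *)
Lemma stein_gE z w : stein_g z w = stein_g_formula z w.
Proof.
rewrite /stein_g; case: eqVneq => [->//|wz].
have dfw := is_derive_stein_fun z w wz.
have dxf : is_derive w 1 (fun x => x * stein_fun z x)
    (w * (w * stein_fun z w + ((w <= z)%R%:R - Phi z)) + stein_fun z w).
  by eapply is_derive_eq; [by repeat derive_step|rewrite /= mulr1].
rewrite stein_solE derive1E; case: dxf => _ ->.
rewrite /stein_g_formula; case: (leP w z) => zw.
  by rewrite stein_fun_le// /mills/= mulr1n; ring.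
by rewrite stein_fun_ge ?ltW// /mills/= mulr0n sqrrN PhiN; ring.
Qed.

Lemma stein_gE_le z w : w <= z -> stein_g z w = stein_profile w * (1 - Phi z).
Proof.
by move=> wz; rewrite stein_gE /stein_g_formula wz /stein_profile /mills; ring.
Qed.

Lemma stein_gE_gt z w : z < w -> stein_g z w = stein_profile (- w) * Phi z.
Proof.
move=> zw; rewrite stein_gE /stein_g_formula leNgt zw /= /stein_profile /mills.
by rewrite sqrrN PhiN; ring.
Qed.

End stein_solution.

(** * Monotonicity and tail bounds of [stein_g] *)

Theorem lemma3p1 (R : realType) (z : R) (hz : 0 < z) :
  (forall w : R, stein_g z w = stein_g_formula z w) /\
  ((forall w1 w2 : R, w1 < w2 -> w2 <= z -> stein_g z w1 < stein_g z w2) /\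
   (forall w1 w2 : R, z < w1 -> w1 < w2 -> stein_g z w2 < stein_g z w1)) /\
  (forall w : R, w < 0 -> stein_g z w <= 3 / (2 * (1 - w) ^+ 3)) /\
  (forall w : R, z < w -> stein_g z w <= 3 / (1 + w) ^+ 3).
Proof.
split; first exact: stein_gE.
split; [split|split].
- move=> w1 w2 w12 w2z; rewrite !stein_gE_le ?(ltW (lt_le_trans w12 w2z))//.
  by rewrite ltr_pM2r ?stein_profile_lt// subr_gt0 Phi_lt1.
- move=> w1 w2 zw1 w12; rewrite !stein_gE_gt ?(lt_trans zw1 w12)//.
  by rewrite ltr_pM2r ?Phi_gt0// stein_profile_lt// ltrN2.
- move=> w w0; rewrite stein_gE_le ?(ltW (lt_trans w0 hz))//.
  (* This is the source of the factor 2 in the denominator: z > 0 gives 1 - Phi(z) = Phi(-z) <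
     Phi(z). *)
  have half : 1 - Phi z <= 2^-1.
    have := Phi_lt (- z) z; rewrite PhiN => /(_ _); lra.
  have q0 : 0 <= 3 / (1 - w) ^+ 3 by rewrite divr_ge0 ?exprn_ge0//; lra.
  rewrite (_ : 3 / _ = 3 / (1 - w) ^+ 3 * 2^-1); last by rewrite invfM mulrCA mulrC.
  apply: (@le_trans _ _ (3 / (1 - w) ^+ 3 * (1 - Phi z))).
    by rewrite ler_wpM2r ?stein_profile_le// subr_ge0 ltW// Phi_lt1.
  by rewrite ler_wpM2l.
- move=> w zw; have w0 := lt_trans hz zw; rewrite stein_gE_gt//.
  have q0 : 0 <= 3 / (1 + w) ^+ 3 by rewrite divr_ge0 ?exprn_ge0//; lra.
  (* The profile is bounded at [- w], which is negative; the remaining factor [Phi z] is bounded by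
     1, so no factor 1/2 appears here. *)
  apply: (@le_trans _ _ (3 / (1 + w) ^+ 3 * Phi z)).
    rewrite ler_wpM2r ?Phi_ge0//.
    by have := @stein_profile_le R (- w); rewrite opprK; apply; lra.
  by rewrite -[leRHS]mulr1 ler_wpM2l// ltW// Phi_lt1.
Qed.
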